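(* Let $T:\mathcal H\rightrightarrows\mathcal H$ be maximal monotone, and let $M:\mathcal H\to\mathcal H$ be a self-adjoint positive semidefinite linear operator. Let $T_*$ and $T_{**}$ be the projected and completion mappings of $T$ relative to the splitting $\mathcal H=H_*\oplus H_{**}$ induced by $M$, that is, $H_*:=\operatorname{rge}M$ and $H_{**}:=\ker M$. If either $0\in\operatorname{int}(\operatorname{rge}T)$ or $M$ is admissible for $T$, then there exists $(\bar z_*,\bar w_* )\in\operatorname{gph}T_*$ such that $T_{**}(\bar z_*,\bar w_* )$ is bounded.
   Context: $\mathcal H$ is a finite-dimensional Hilbert space. Relative to the orthogonal decomposition $\mathcal H=H_*\oplus H_{**}$, each $z\in\mathcal H$ is written $z=(z_*,z_{**})$ with $z_*\in H_*$, $z_{**}\in H_{**}$. The projected mapping $T_*:H_*\rightrightarrows H_*$ and the completion mapping $T_{**}:H_*\times H_*\rightrightarrows H_{**}$ are defined by $$w_*\in T_*(z_* )\iff\exists z_{**}\in H_{**}\text{ such that }(w_*,0)\in T(z_*,z_{**}),$$ $$T_{**}(z_*,w_* ):=\{z_{**}\in H_{**}\mid(w_*,0)\in T(z_*,z_{**})\}.$$ $M$ is called admissible for $T$ if the mapping $(M+T)^{-1}M$ is both everywhere defined and single-valued on $\mathcal H$, i.e. for every $x\in\mathcal H$ there is exactly one $z\in\mathcal H$ with $Mx\in Mz+T(z)$. $\operatorname{rge}$ denotes range and $\operatorname{int}$ denotes interior in $\mathcal H$. *)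

(* Defs.v *)
From HB Require Import structures.
From mathcomp Require Import all_boot all_order all_algebra.
From mathcomp Require Import all_classical all_reals all_analysis.

Set Implicit Arguments.
Unset Strict Implicit.
Unset Printing Implicit Defensive.

Import Order.TTheory GRing.Theory Num.Theory.
Import numFieldNormedType.Exports.

Local Open Scope classical_set_scope.
Local Open Scope ring_scope.

(* A real finite-dimensional Hilbert space: a finite-dimensional (vectType)
   normed space whose norm is induced by an inner product. The topology is the
   norm topology; completeness is automatic in finite dimension. *)
HB.mixin Record hasInnerProduct (R : realType) (V : Type)
    of NormedModule R V := {
  inner : {dot V for idfun} ;
  norm_inner : forall x : V, `|x| = Num.sqrt (inner x x) }.

#[short(type="finHilbertType")]
HB.structure Definition FinHilbert (R : realType) :=
  {V of NormedModule R V & Vector R V & hasInnerProduct R V}.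

(* A set-valued mapping F : A => B is a function F : A -> set B, with
   empty values allowed. *)
Definition gph (A B : Type) (F : A -> set B) : set (A * B) :=
  [set p | F p.1 p.2].

Definition rge (A B : Type) (F : A -> set B) : set B :=
  [set w | exists z, F z w].

Section Operators.
Variables (R : realType) (H : finHilbertType R).
Implicit Types (S T : H -> set H) (M : 'End(H)) (Hs Hss : {vspace H}).

Definition monotone T : Prop :=
  forall z z' w w' : H, T z w -> T z' w' -> 0 <= inner (z - z') (w - w').

Definition maximal_monotone T : Prop :=
  monotone T /\ forall S, monotone S -> gph T `<=` gph S -> gph S = gph T.

Definition self_adjoint M : Prop :=
  forall x y : H, inner (M x) y = inner x (M y).

Definition positive_semidefinite M : Prop :=
  forall x : H, 0 <= inner x (M x).

(* Elements of the subspaces Hs, Hss are regarded as vectors of H, so that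
   the pair (z_*, z_** ) is the sum z_* + z_**, and (w_*, 0) is w_*. *)
Definition projected_mapping Hs Hss T : H -> set H :=
  fun zs => [set ws | [/\ zs \in Hs, ws \in Hs &
    exists2 zss, zss \in Hss & T (zs + zss) ws]].

Definition completion_mapping Hss T : H * H -> set H :=
  fun p => [set zss | zss \in Hss /\ T (p.1 + zss) p.2].

Definition admissible M T : Prop :=
  forall x : H, exists! z : H, exists2 w : H, T z w & M x = M z + w.

End Operators.

(* Main.v *)
(* If [0] is interior to [rge T], take [w = 0] and any zero [z] of [T]: by
   monotonicity, points of [T] whose image is a small vector in a prescribed
   direction bound the zero set of [T] in that direction, and the completion
   set is a translate of a subset of this zero set.
   If [M] is admissible, take the unique [z] with [M 0 = M z + w], [w] in
   [T z]: any [u] in the completion set at [(z_*, w)] gives another solution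
   [z_* + u] of the same inclusion, so this set is a singleton. *)

Require Import Defs.
From HB Require Import structures.
From mathcomp Require Import all_boot all_order all_algebra.
From mathcomp Require Import all_classical all_reals all_analysis.

Set Implicit Arguments.
Unset Strict Implicit.
Unset Printing Implicit Defensive.

Import Order.TTheory GRing.Theory Num.Theory.
Import numFieldNormedType.Exports.

Local Open Scope classical_set_scope.
Local Open Scope ring_scope.

Lemma bounded_setP (R : realType) (V : normedModType R) (A : set V) :
  bounded_set A <-> exists K : R, forall z, A z -> `|z| <= K.
Proof.
split=> [[K0 [_ K0P]]|[K KP]].
  by exists (K0 + 1) => z Az; apply: K0P Az; rewrite ltrDl.
by exists K; split=> [|x Kx z /KP zK /=];
  rewrite ?num_real// (le_trans zK)// ltW.
Qed.

Section InnerProduct.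
Variables (R : realType) (H : finHilbertType R).
Implicit Types (x y z : H) (A : set H) (M : 'End(H)).

Lemma inner_eq0 x : inner x x = 0 -> x = 0.
Proof.
have [-> //|/(@neq0_dnorm_gt0 _ _ _ (@inner R H)) + xx0] := eqVneq x 0.
by rewrite xx0 ltxx.
Qed.

Lemma innerC x y : inner x y = inner y x.
Proof. by rewrite (hermC (@inner R H)) expr0 mul1r. Qed.

Lemma innerDZl (a : R) x y z :
  inner (a *: x + y) z = a * inner x z + inner y z.
Proof. exact: (linearPl (@inner R H)). Qed.

Lemma innerZr x (a : R) y : inner x (a *: y) = a * inner x y.
Proof. exact: (linearZr_LR (@inner R H)). Qed.

Lemma innerNr x y : inner x (- y) = - inner x y.
Proof. exact: (linearNr (@inner R H)). Qed.

Lemma innerBl x y z : inner (x - y) z = inner x z - inner y z.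
Proof. exact: (linearBl (@inner R H)). Qed.

Lemma inner_sumr x (I : finType) (F : I -> H) :
  inner x (\sum_i F i) = \sum_i inner x (F i).
Proof. exact: (linear_sumr (@inner R H)). Qed.

Definition basis_products z : 'rV[R]_(\dim {: H}) :=
  \row_i inner z (vbasis {: H})`_i.

Fact basis_products_linear : linear basis_products.
Proof. by move=> a x y; apply/rowP => i; rewrite !mxE innerDZl. Qed.

HB.instance Definition _ := GRing.isLinear.Build R H _ _ basis_products
  basis_products_linear.

(** A vector orthogonal to every basis vector is, by expanding it in that basis, orthogonal to
    itself, hence zero. *)
Lemma basis_products_inj : injective (linfun basis_products).
Proof.
apply/lker0P; rewrite -subv0; apply/subvP => z.
rewrite memv_ker lfunE /= => /eqP z0; rewrite memv0; apply/eqP/inner_eq0.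
rewrite {2}(coord_vbasis (memvf z)) inner_sumr big1 // => i _.
rewrite innerZr.
by have /rowP/(_ i) := z0; rewrite !mxE => ->; rewrite mulr0.
Qed.

(* Finite dimension lets one recover z linearly from its inner products with
   a basis, so the scalar bounds combine into a norm bound. *)
Lemma weakly_bounded A :
  (forall y, exists C : R, forall z, A z -> inner z y <= C) -> bounded_set A.
Proof.
move=> Aub.
have /choice[C CP] : forall y, exists C : R, forall z, A z -> `|inner z y| <= C.
  (* The upper bound in direction [- y] serves as a lower bound in direction [y]. *)
  move=> y; have [C1 C1P] := Aub y; have [C2 C2P] := Aub (- y).
  exists (Num.max C1 C2) => z Az; rewrite ler_norml lerNl !le_max C1P ?orbT//.
  by rewrite -innerNr C2P ?orbT.
pose g := linfun basis_products.
apply/bounded_setP.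
exists (\sum_(i < \dim {: H})
          C (vbasis {: H})`_i * `|g^-1%VF (delta_mx 0 i)|).
move=> z Az /=.
have /lker0P/lker0_lfunK gK := basis_products_inj.
rewrite -[in leLHS](gK z) [g z]row_sum_delta linear_sum.
apply: (le_trans (ler_norm_sum _ _ _)); apply: ler_sum => i _.
by rewrite linearZ normrZ ler_wpM2r// lfunE mxE CP.
Qed.

(** If [x = M y] and [M x = 0], then [inner x x = inner y (M x) = 0], so range and kernel meet only
    in 0; rank-nullity then makes their sum the whole space. *)
Lemma self_adjoint_split M : self_adjoint M -> (limg M + lker M = fullv)%VS.
Proof.
move=> Msa; apply/eqP; rewrite eqEdim subvf dimv_disjoint_sum.
  by rewrite addnC -(limg_ker_dim M fullv) capfv leqnn.
apply/eqP; rewrite -subv0; apply/subvP => x /memv_capP[/memv_imgP[y _ ->]].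
rewrite memv_ker memv0 => /eqP MMy0; apply/eqP/inner_eq0.
by rewrite Msa MMy0 (linear0r (@inner R H)).
Qed.

Lemma self_adjoint_decomp M x : self_adjoint M ->
  exists2 u, u \in limg M & exists2 v, v \in lker M & x = u + v.
Proof. by move=> Msa; apply/memv_addP; rewrite self_adjoint_split ?memvf. Qed.

End InnerProduct.

(* If w : T y is a small positive multiple of b then monotonicity between
   (z, 0) and (y, w) reads inner z w <= inner y w, which bounds inner z b. *)
Lemma monotone_zeros_bounded (R : realType) (H : finHilbertType R)
    (T : H -> set H) :
  Defs.monotone T -> interior (rge T) 0 -> bounded_set [set z | T z 0].
Proof.
move=> Tmon Tint; apply: weakly_bounded => b.
have /nbhs_ballP[e /= e0 eT] := Tint.
(* The [+ 1] allows [b = 0] and makes the norm of [t *: b] strictly less than [e]. *)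
pose t := e / (`|b| + 1).
have b1 : 0 < `|b| + 1 by rewrite ltr_wpDl.
have t0 : 0 < t by rewrite divr_gt0.
have [y Tyb] : rge T (t *: b).
  apply: eT; rewrite -ball_normE /= sub0r normrN normrZ gtr0_norm//.
  by rewrite /t mulrAC ltr_pdivrMr// ltr_pM2l// ltrDl.
exists (inner y b) => z Tz.
have := Tmon _ _ _ _ Tz Tyb.
by rewrite sub0r innerNr innerZr oppr_ge0 pmulr_rle0// innerBl subr_le0.
Qed.

Theorem proposition3p7 (R : realType) (H : finHilbertType R)
    (T : H -> set H) (M : 'End(H))
    (hT : maximal_monotone T)
    (hMsa : self_adjoint M) (hMpsd : positive_semidefinite M)
    (hor : interior (rge T) 0 \/ admissible M T) :
  exists zs ws : H,
    gph (projected_mapping (limg M) (lker M) T) (zs, ws) /\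
    bounded_set (completion_mapping (lker M) T (zs, ws)).
Proof.
case: hor => [Tint|Madm].
  have [z Tz] := interior_subset Tint.
  have [zs zsM [zss zssM zE]] := self_adjoint_decomp z hMsa.
  exists zs, 0; split.
    by split=> /=; rewrite ?mem0v//; exists zss => //; rewrite -zE.
  have /bounded_setP[K KP] := monotone_zeros_bounded hT.1 Tint.
  apply/bounded_setP; exists (K + `|zs|) => u [_ /= Tu].
  (* Here [u = (zs + u) - zs], where [zs + u] is a zero of [T]. *)
  by rewrite -[u in leLHS](addKr zs) addrC (le_trans (ler_normB _ _))// lerD2r KP.
have [z [[w Tzw M0E] zuniq]] := Madm 0.
have [zs zsM [zss zssM zE]] := self_adjoint_decomp z hMsa.
have Mu u : u \in lker M -> M (zs + u) = M z.
  move=> uM; rewrite zE !linearD /=; move: uM zssM.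
  by rewrite !memv_ker => /eqP-> /eqP->.
(* Since [M 0 = 0], the inclusion at 0 reads [w = - M z]. *)
have wM : w \in limg M.
  have -> : w = M (0 - z) by rewrite linearB /= M0E addrAC subrr add0r.
  by rewrite memv_img ?memvf.
exists zs, w; split.
  by split=> //=; exists zss => //; rewrite -zE.
apply/bounded_setP; exists `|z - zs| => u [uM /= Tu].
have -> // : z - zs = u.
rewrite (zuniq (zs + u)) 1?addrAC ?subrr ?add0r//.
by exists w => //; rewrite Mu.
Qed.
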